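(* Let $\mathcal{C}$ be a $k$-linear Reedy category. Then the assignment $c\mapsto L_c$ provides a bijection between (i) the objects of $\mathcal{C}$ and (ii) the isomorphism classes of simple left $\mathcal{C}$-modules.
   Context: $k$ is a field and $\mathcal{K}$ is the category of $k$-vector spaces. A small $k$-linear category $\mathcal{D}$ is called direct (resp. inverse) if $\operatorname{End}_{\mathcal{D}}(c)\cong k$ for every object $c$, and there are an ordinal $\lambda$ and a function $\deg\colon\operatorname{Obj}(\mathcal{D})\to\lambda$ such that every non-zero non-endomorphism $c\to c'$ satisfies $\deg(c)<\deg(c')$ (resp. $\deg(c)>\deg(c')$). A small $k$-linear category $\mathcal{C}$ is called $k$-linear Reedy if there are an ordinal $\lambda$, a function $\deg\colon\operatorname{Obj}(\mathcal{C})\to\lambda$, and two $k$-linear subcategories $\mathcal{C}^+,\mathcal{C}^-$ of $\mathcal{C}$ with the same objects as $\mathcal{C}$, with $\mathcal{C}^+$ direct and $\mathcal{C}^-$ inverse with respect to the same function $\deg$, such that for all objects $c,d$ composition induces a $k$-linear isomorphism $\bigoplus_{e\in\operatorname{Obj}(\mathcal{C})}\mathcal{C}^+(e,d)\otimes_k\mathcal{C}^-(c,e)\cong\mathcal{C}(c,d)$. These data are fixed. A left $\mathcal{C}$-module is a $k$-linear functor $\mathcal{C}\to\mathcal{K}$. For an ordinal $\alpha\le\lambda$ and objects $c,d$, let $\mathcal{I}^{\mathcal{C}}_{<\alpha}(c,d)\subseteq\mathcal{C}(c,d)$ be the image of the composition map $\bigoplus_{\deg(e)<\alpha}\mathcal{C}^+(e,d)\otimes_k\mathcal{C}^-(c,e)\to\mathcal{C}(c,d)$;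 this defines a two-sided ideal of $\mathcal{C}$. For an object $c$ of degree $\alpha$, the standard left $\mathcal{C}$-module of $c$ is $\Delta_c:=\mathcal{C}(c,-)/\mathcal{I}^{\mathcal{C}}_{<\alpha}(c,-)$. Each $\Delta_c$ has a unique maximal submodule, and $L_c$ denotes the corresponding unique simple quotient of $\Delta_c$. *)

(* Defs.v *)
From HB Require Import structures.
From mathcomp Require Import all_boot all_order all_algebra.
From mathcomp Require Import boolp classical_sets functions cardinality fsbigop.
From mathcomp Require Import finmap freeg.

Set Implicit Arguments.
Unset Strict Implicit.
Unset Printing Implicit Defensive.

Import Order.TTheory GRing.Theory.

Local Open Scope classical_set_scope.
Local Open Scope quotient_scope.
Local Open Scope ring_scope.

Section Subspace.
Context {k : fieldType} {V : lmodType k} (S : submodClosed V).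

Definition subvec := {x : V | x \in S}.

HB.instance Definition _ := SubChoice.on subvec.
HB.instance Definition _ := [SubChoice_isSubLmodule of subvec by <:].

(* the predicate S again, with the additive-subgroup structure required by
   [Quotient.quot] *)
Definition zmod_pred : {pred V} := fun x => x \in S.

Fact zmod_pred_closed : zmod_closed zmod_pred.
Proof.
split=> [|x y]; first exact: (rpred0 S).
move=> xS yS; suff: x - y \in S by [].
by rewrite -scaleN1r rpredD ?rpredZ.
Qed.

HB.instance Definition _ := GRing.isZmodClosed.Build V zmod_pred zmod_pred_closed.

Definition vquot := @Quotient.quot V zmod_pred.

HB.instance Definition _ := GRing.Zmodule.on vquot.

Definition vpi (x : V) : vquot := \pi_(@Quotient.quot V zmod_pred) x.

Lemma vpi_eq x y : (vpi x = vpi y) <-> x - y \in S.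
Proof.
rewrite /vpi; split=> [e|xy].
  by have := @Quotient.idealrBE V zmod_pred x y; rewrite e eqxx.
by apply/eqP; rewrite -(@Quotient.idealrBE V zmod_pred).
Qed.

Lemma vpi_zmod : zmod_morphism vpi.
Proof. exact: raddfB. Qed.
HB.instance Definition _ := GRing.isZmodMorphism.Build V vquot vpi vpi_zmod.

Definition vrepr (x : vquot) : V := repr x.
Lemma vreprK : cancel vrepr vpi.
Proof. exact: reprK. Qed.

Definition vquot_scale (a : k) (x : vquot) : vquot := vpi (a *: vrepr x).

Lemma vpi_scale a x : vquot_scale a (vpi x) = vpi (a *: x).
Proof. 
by apply/vpi_eq; rewrite -scalerBr rpredZ //; apply/vpi_eq; exact: vreprK.
Qed.

Fact vquot_scaleA a b x : vquot_scale a (vquot_scale b x) = vquot_scale (a * b) x.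
Proof. by rewrite -[x]vreprK !vpi_scale scalerA. Qed.
Fact vquot_scale1 : left_id 1 vquot_scale.
Proof. by move=> x; rewrite -[x]vreprK !vpi_scale scale1r. Qed.
Fact vquot_scaleDr : right_distributive vquot_scale +%R.
Proof.
by move=> a x y; rewrite -[x]vreprK -[y]vreprK -raddfD !vpi_scale scalerDr raddfD.
Qed.
Fact vquot_scaleDl x : {morph vquot_scale^~ x : a b / a + b}.
Proof. by move=> a b; rewrite -[x]vreprK !vpi_scale scalerDl raddfD. Qed.
HB.instance Definition _ := GRing.Zmodule_isLmodule.Build k vquot
  vquot_scaleA vquot_scale1 vquot_scaleDr vquot_scaleDl.

Fact vpi_scalable : scalable vpi.
Proof. by move=> a x; rewrite -vpi_scale. Qed.
HB.instance Definition _ := GRing.isScalable.Build k V vquot *:%R vpi vpi_scalable.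

Lemma vpiZ a x : vpi (a *: x) = a *: vpi x.
Proof. exact: vpi_scalable. Qed.

End Subspace.

Section Span.
Context {k : fieldType} {V : lmodType k} (A : set V).

Definition vspan : {pred V} :=
  fun x => `[< forall S : submodClosed V, (forall a, A a -> a \in S) -> x \in S >].

Fact vspan_closed : submod_closed vspan.
Proof.
split=> [|a x y /asboolP hx /asboolP hy].
  by apply/asboolP => S _; exact: rpred0.
by apply/asboolP => S AS; rewrite rpredD ?rpredZ ?hx ?hy.
Qed.
HB.instance Definition _ := GRing.isSubmodClosed.Build k V vspan vspan_closed.

Lemma vspanS x : A x -> x \in vspan.
Proof. by move=> Ax; apply/asboolP => S; exact. Qed.

End Span.

Section MkSubmod.
Context {k : fieldType} {V : lmodType k} (P : {pred V}) (h : submod_closed P).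
Definition mk_submod : submodClosed V :=
  HB.pack_for (submodClosed V) P (GRing.isSubmodClosed.Build k V P h).
Lemma mk_submodE x : (x \in mk_submod) = (x \in P).
Proof. by []. Qed.
End MkSubmod.

Section Preim.
Context {k : fieldType} {U V : lmodType k}.

Lemma preim_submod_closed (f : U -> V) (S : submodClosed V) :
  linear f -> submod_closed (fun x => f x \in S : bool).
Proof.
move=> lf; have f0 : f 0 = 0.
  by have := lf (-1) 0 0; rewrite scaleN1r oppr0 addr0 scaleN1r addNr.
split=> [|a x y]; first by rewrite unfold_in f0 rpred0.
by rewrite !unfold_in => hx hy; have: a *: f x + f y \in S
   by [rewrite rpredD ?rpredZ]; rewrite -lf.
Qed.

Definition vpreim (f : U -> V) (S : submodClosed V) (lf : linear f) : submodClosed U :=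
  mk_submod (preim_submod_closed S lf).

Lemma vpreimE (f : U -> V) (S : submodClosed V) (lf : linear f) x :
  (x \in vpreim S lf) = (f x \in S).
Proof. by []. Qed.

Fact vzero_closed : submod_closed (fun x : V => x == 0).
Proof.
by split=> [|a x y /eqP-> /eqP->]; rewrite unfold_in ?eqxx // scaler0 addr0.
Qed.
Definition vzero : submodClosed V := mk_submod vzero_closed.
Lemma vzeroE x : (x \in vzero) = (x == 0).
Proof. by []. Qed.

Lemma lin_span (A : set U) (f : U -> V) (S : submodClosed V) : linear f ->
  (forall a, A a -> f a \in S) -> forall x, x \in vspan A -> f x \in S.
Proof.
move=> lf fA x /asboolP /(_ (vpreim S lf)); apply=> a Aa.
by rewrite vpreimE fA.
Qed.

End Preim.

Section Freeg.
Context {k : fieldType} {K : choiceType} {U : lmodType k} (f : K -> U).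

Lemma fglift_linear : linear (fglift f : {freeg K / k} -> U).
Proof.
have addf : zmod_morphism (fglift f : {freeg K / k} -> U) by exact: lift_is_additive.
have [g gE] : exists g : {additive {freeg K / k} -> U}, g =1 fglift f.
  by exists (HB.pack_for {additive {freeg K / k} -> U}
    (fglift f : {freeg K / k} -> U)
    (GRing.isZmodMorphism.Build {freeg K / k} U (fglift f : {freeg K / k} -> U) addf)).
move=> a x y; rewrite -!gE raddfD; congr (_ + _).
have -> : a *: x = \sum_(z <- dom x) << a * coeff z x *g z >> by [].
rewrite -[in RHS](freeg_sumE x) !raddf_sum.
by apply: eq_bigr => z _; rewrite /= !gE !liftU scalerA.
Qed.

End Freeg.

Definition is_bilinear {k : fieldType} {U V W : lmodType k} (f : U -> V -> W) :=
  (forall v, linear (f^~ v)) /\ (forall u, linear (f u)).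

Section Tensor.
Context {k : fieldType} (V W : lmodType k).

Definition bilinear_relations : set {freeg (V * W)%type / k} :=
  [set r | (exists a v v' w,
              r = << (a *: v + v', w) >> - a *: << (v, w) >> - << (v', w) >>)
        \/ (exists a v w w',
              r = << (v, a *: w + w') >> - a *: << (v, w) >> - << (v, w') >>)].

Definition tensor := vquot (vspan bilinear_relations).
HB.instance Definition _ := GRing.Lmodule.on tensor.

Definition tens (v : V) (w : W) : tensor :=
  vpi (vspan bilinear_relations) << (v, w) >>.

Context {U : lmodType k}.

(* By [tlift_tens] and [tlift_linear] the representative does not matter when f
   is bilinear. *)
Definition tlift (f : V -> W -> U) (t : tensor) : U :=
  fglift (fun p : V * W => f p.1 p.2) (vrepr t).

Section Bilin.
Variables (f : V -> W -> U) (hf : is_bilinear f).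
Let F := fglift (fun p : V * W => f p.1 p.2) : {freeg (V * W)%type / k} -> U.
Let Flin : linear F. Proof. exact: fglift_linear. Qed.
Let FE p : F << p >> = f p.1 p.2. Proof. by rewrite /F liftU scale1r. Qed.
Let FB x y : F (x - y) = F x - F y.
Proof. by rewrite -[- y]scaleN1r [x + _]addrC Flin scaleN1r addrC. Qed.
Let F0 : F 0 = 0. Proof. by rewrite -(subrr 0) FB subrr. Qed.
Let FZ a x : F (a *: x) = a *: F x.
Proof. by rewrite -[a *: x]addr0 Flin F0 addr0. Qed.

Let Frel x : x \in vspan bilinear_relations -> F x = 0.
Proof.
move=> xs; apply/eqP; rewrite -vzeroE; apply: lin_span xs => //.
move=> r [] [a [v [w [u ->]]]]; rewrite vzeroE !FB FZ !FE /=.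
  by rewrite (hf.1 u) addrAC addrK subrr.
by rewrite (hf.2 v) addrAC addrK subrr.
Qed.

Let tliftE x : tlift f (vpi _ x) = F x.
Proof.
apply/eqP; rewrite -subr_eq0 -FB; apply/eqP/Frel/vpi_eq; exact: vreprK.
Qed.

Lemma tlift_tens v w : tlift f (tens v w) = f v w.
Proof. by rewrite tliftE FE. Qed.

Lemma tlift_linear : linear (tlift f).
Proof.
move=> a x y; rewrite -[x]vreprK -[y]vreprK -linearP !tliftE; exact: Flin.
Qed.
End Bilin.

Lemma tensor_ind (S : submodClosed tensor) :
  (forall v w, tens v w \in S) -> forall t, t \in S.
Proof.
move=> hS t; rewrite -[t]vreprK -[vrepr t]freeg_sumE raddf_sum.
apply: rpred_sum => -[v w] _.
suff -> : << coeff (v, w) (vrepr t) *g (v, w) >> = coeff (v, w) (vrepr t) *: << (v, w) >>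
   :> {freeg (V * W)%type / k}.
  by rewrite [X in X \in _]vpiZ rpredZ //; exact: hS.
by apply/eqP/freeg_eqP => z; rewrite coeffZ !coeffU mul1r.
Qed.

End Tensor.

Section DirectSum.
Context {k : fieldType} {I : choiceType} (M : I -> lmodType k).

Definition dprod := forall i, M i.
HB.instance Definition _ := Choice.on dprod.

Definition dprod_add (x y : dprod) : dprod := fun i => x i + y i.
Definition dprod_zero : dprod := fun i => 0.
Definition dprod_opp (x : dprod) : dprod := fun i => - x i.
Definition dprod_scale (a : k) (x : dprod) : dprod := fun i => a *: x i.
Fact dprod_ext (x y : dprod) : (forall i, x i = y i) -> x = y.
Proof. exact: functional_extensionality_dep. Qed.
Fact dprod_addA : associative dprod_add. Proof. by move=> x y z; apply: dprod_ext => i; exact: addrA. Qed.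
Fact dprod_addC : commutative dprod_add. Proof. by move=> x y; apply: dprod_ext => i; exact: addrC. Qed.
Fact dprod_add0 : left_id dprod_zero dprod_add. Proof. by move=> x; apply: dprod_ext => i; exact: add0r. Qed.
Fact dprod_addN : left_inverse dprod_zero dprod_opp dprod_add. Proof. by move=> x; apply: dprod_ext => i; exact: addNr. Qed.
HB.instance Definition _ := GRing.isZmodule.Build dprod dprod_addA dprod_addC dprod_add0 dprod_addN.
Fact dprod_scaleA a b x : dprod_scale a (dprod_scale b x) = dprod_scale (a * b) x.
Proof. by apply: dprod_ext => i; exact: scalerA. Qed.
Fact dprod_scale1 : left_id 1 dprod_scale. Proof. by move=> x; apply: dprod_ext => i; exact: scale1r. Qed.
Fact dprod_scaleDr : right_distributive dprod_scale +%R.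
Proof. by move=> a x y; apply: dprod_ext => i; exact: scalerDr. Qed.
Fact dprod_scaleDl x : {morph dprod_scale^~ x : a b / a + b}.
Proof. by move=> a b; apply: dprod_ext => i; exact: scalerDl. Qed.
HB.instance Definition _ := GRing.Zmodule_isLmodule.Build k dprod
  dprod_scaleA dprod_scale1 dprod_scaleDr dprod_scaleDl.

Definition fin_support : {pred dprod} := fun x => `[< finite_set [set i | x i != 0] >].

Fact fin_support_closed : submod_closed fin_support.
Proof.
split=> [|a x y /asboolP hx /asboolP hy]; apply/asboolP.
  by apply: (sub_finite_set _ (finite_set0 I)) => i /=; rewrite eqxx.
apply: (@sub_finite_set _ _ ([set i | x i != 0] `|` [set i | y i != 0])).
  move=> i /=; apply: contra_neqP => /not_orP[/negP/negPn/eqP xi0 /negP/negPn/eqP yi0].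
  by rewrite -[LHS]/(a *: x i + y i) xi0 yi0 scaler0 addr0.
by rewrite finite_setU.
Qed.
HB.instance Definition _ := GRing.isSubmodClosed.Build k dprod fin_support fin_support_closed.

Definition dsum := subvec fin_support.
HB.instance Definition _ := GRing.Lmodule.on dsum.

Definition dproj (x : dsum) (i : I) : M i := val x i.

Lemma dprojP a x y i : dproj (a *: x + y) i = a *: dproj x i + dproj y i.
Proof. by rewrite /dproj linearP. Qed.

Lemma dproj_fin (x : dsum) : finite_set [set i | dproj x i != 0].
Proof. exact/asboolP/(valP x). Qed.

Definition dsingle_fun (i : I) (m : M i) : dprod := fun j =>
  if i =P j is ReflectT e then ecast j (M j) e m else 0.

Fact dsingle_finsupp i (m : M i) : dsingle_fun m \in fin_support.
Proof.
apply/asboolP/(@sub_finite_set _ _ [set i]); last exact: finite_set1.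
by move=> j /=; rewrite /dsingle_fun; case: (i =P j) => [e _|]; [exact: esym|rewrite eqxx].
Qed.
Definition dsingle i (m : M i) : dsum := exist _ (dsingle_fun m) (dsingle_finsupp m).

Lemma dproj_single i (m : M i) : dproj (dsingle m) i = m.
Proof.
by rewrite /dproj /= /dsingle_fun; case: eqP => // e; rewrite (eq_axiomK e).
Qed.

Lemma dproj_single0 i (m : M i) j : j <> i -> dproj (dsingle m) j = 0.
Proof.
by move=> ji; rewrite /dproj /= /dsingle_fun; case: eqP => // e; case: ji.
Qed.

Context {U : lmodType k}.

Definition dlift (f : forall i, M i -> U) (x : dsum) : U :=
  \sum_(i \in [set: I]) f i (dproj x i).

Section Lift.
Variable (f : forall i, M i -> U).
Arguments f : clear implicits.
Hypothesis (lf : forall i, linear (f i)).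
Let f0 i : f i 0 = 0.
Proof. by have := @lf i (-1) 0 0; rewrite scaleN1r oppr0 addr0 scaleN1r addNr. Qed.

Let dliftE (x : dsum) (r : {fset I}) :
  (forall i, i \notin r -> dproj x i = 0) -> dlift f x = \sum_(i <- r) f i (dproj x i).
Proof. by move=> h; apply: fsbigTE => i /h ->. Qed.

Lemma dlift_linear : linear (dlift f).
Proof.
move=> a x y.
pose r := fset_set ([set i | dproj x i != 0] `|` [set i | dproj y i != 0]).
have hr i : i \notin r -> dproj x i = 0 /\ dproj y i = 0.
  rewrite in_fset_set; last by rewrite finite_setU; split; exact: dproj_fin.
  by rewrite notin_setE => /not_orP[/negP/negPn/eqP -> /negP/negPn/eqP ->].
rewrite (@dliftE x r) => [|i /hr[]//]; rewrite (@dliftE y r) => [|i /hr[]//].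
rewrite (@dliftE _ r) => [|i /hr[xi yi]]; last first.
  by rewrite dprojP xi yi scaler0 addr0.
by rewrite scaler_sumr -big_split; apply: eq_bigr => i _; rewrite dprojP lf.
Qed.

Lemma dlift_single i (m : M i) : dlift f (dsingle m) = f i m.
Proof.
rewrite (@dliftE _ [fset i]%fset) => [|j]; last first.
  by rewrite in_fset1 => /eqP/dproj_single0.
by rewrite big_seq_fset1 dproj_single.
Qed.

Lemma dlift_in (S : submodClosed U) (x : dsum) :
  (forall i, f i (dproj x i) \in S) -> dlift f x \in S.
Proof. by move=> h; apply: rpred_sum => i _. Qed.
End Lift.

End DirectSum.

Record lincat (k : fieldType) := LinCat {
  obj :> Type;
  hom : obj -> obj -> lmodType k;
  idm : forall c, hom c c;
  hcomp : forall a b c, hom b c -> hom a b -> hom a c;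
  hcomp_bilinear : forall a b c, is_bilinear (@hcomp a b c);
  hcompA : forall a b c d (f : hom c d) (g : hom b c) (h : hom a b),
    hcomp f (hcomp g h) = hcomp (hcomp f g) h;
  hcomp1m : forall a b (f : hom a b), hcomp (idm b) f = f;
  hcompm1 : forall a b (f : hom a b), hcomp f (idm a) = f }.

Arguments idm {k l} c.
Arguments hcomp {k l a b c}.
Arguments hom {k} l.

(* Objects form an arbitrary type, which classical logic makes a choiceType;
   this is what lets finite-support sums range over objects. *)
HB.instance Definition _ (k : fieldType) (C : lincat k) := gen_eqMixin (obj C).
HB.instance Definition _ (k : fieldType) (C : lincat k) := gen_choiceMixin (obj C).

Section Subcategory.
Context {k : fieldType} (C : lincat k).

Record subcat := Subcat {
  shom : forall a b : C, submodClosed (hom C a b);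
  sub_id : forall c, idm c \in shom c c;
  sub_comp : forall a b c (g : hom C b c) (f : hom C a b),
    g \in shom b c -> f \in shom a b -> hcomp g f \in shom a c }.

Variable S : subcat.

Definition scat_hom (a b : C) : lmodType k := subvec (shom S a b).
Definition scat_id c : scat_hom c c := exist _ (idm c) (sub_id S c).
Definition scat_comp a b c (g : scat_hom b c) (f : scat_hom a b) : scat_hom a c :=
  exist _ (hcomp (val g) (val f)) (sub_comp (valP g) (valP f)).

Lemma scat_valP a b r (x y : scat_hom a b) : val (r *: x + y) = r *: val x + val y.
Proof. by []. Qed.

Fact scat_bilinear a b c : is_bilinear (@scat_comp a b c).
Proof.
split=> u r x y; apply: val_inj.
  exact: (hcomp_bilinear _ _ _).1.
exact: (hcomp_bilinear _ _ _).2.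
Qed.

Fact scat_compA a b c d (f : scat_hom c d) (g : scat_hom b c) (h : scat_hom a b) :
  scat_comp f (scat_comp g h) = scat_comp (scat_comp f g) h.
Proof. by apply: val_inj; exact: hcompA. Qed.
Fact scat_comp1m a b (f : scat_hom a b) : scat_comp (scat_id b) f = f.
Proof. by apply: val_inj; exact: hcomp1m. Qed.
Fact scat_compm1 a b (f : scat_hom a b) : scat_comp f (scat_id a) = f.
Proof. by apply: val_inj; exact: hcompm1. Qed.

Definition scat : lincat k :=
  LinCat scat_bilinear scat_compA scat_comp1m scat_compm1.

End Subcategory.

Section Reedy.
Context {k : fieldType}.

Definition trivial_end (D : lincat k) := forall c : D, exists f : k^o -> hom D c c,
  [/\ linear f, bijective f, f 1 = idm c & forall a b, f (a * b) = hcomp (f a) (f b)].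

(* The codomain of the degree is any total order here; [reedy] asks for a
   well-order, i.e. an ordinal up to isomorphism. *)
Definition direct_cat {disp} {Lam : orderType disp} (D : lincat k) (rdeg : D -> Lam) :=
  trivial_end D /\
  forall (c c' : D) (f : hom D c c'), f != 0 -> c <> c' -> (rdeg c < rdeg c')%O.

Definition inverse_cat {disp} {Lam : orderType disp} (D : lincat k) (rdeg : D -> Lam) :=
  trivial_end D /\
  forall (c c' : D) (f : hom D c c'), f != 0 -> c <> c' -> (rdeg c' < rdeg c)%O.

Section Factorisation.
Context {C : lincat k} (Cp Cm : subcat C).

Definition fact_space (c d : C) : lmodType k :=
  dsum (fun e : obj C => tensor (scat_hom Cp e d) (scat_hom Cm c e)).

Definition pcomp (c d e : C) (g : scat_hom Cp e d) (h : scat_hom Cm c e) : hom C c d :=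
  hcomp (val g) (val h).

Definition comp_map (c d : C) : fact_space c d -> hom C c d :=
  dlift (fun e : obj C => tlift (@pcomp c d e)).

End Factorisation.

(* [comp_map] is linear ([comp_map_linear]), so bijectivity says that it is a
   linear isomorphism. *)
Record reedy (C : lincat k) := Reedy {
  rdisp : Order.disp_t;
  rlam : orderType rdisp;
  rlam_wf : well_founded (fun x y : rlam => (x < y)%O);
  rdeg : C -> rlam;
  rplus : subcat C;
  rminus : subcat C;
  rplus_direct : @direct_cat _ rlam (scat rplus) rdeg;
  rminus_inverse : @inverse_cat _ rlam (scat rminus) rdeg;
  comp_map_bij : forall c d, bijective (@comp_map C rplus rminus c d) }.

End Reedy.

Section Modules.
Context {k : fieldType} {C : lincat k}.

Record cmod := CMod {
  msp :> obj C -> lmodType k;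
  mact : forall a b, hom C a b -> msp a -> msp b;
  mact_bilinear : forall a b, is_bilinear (@mact a b);
  mact1 : forall a (x : msp a), mact (idm a) x = x;
  mactM : forall a b c (g : hom C b c) (f : hom C a b) (x : msp a),
    mact (hcomp g f) x = mact g (mact f x) }.

Record submod (M : cmod) := Submod {
  ssp :> forall a, submodClosed (M a);
  ssp_act : forall a b (f : hom C a b) (x : M a), x \in ssp a -> mact f x \in ssp b }.

Definition proper_submod (M : cmod) (N : submod M) := exists a (x : M a), x \notin N a.

Definition maximal_submod (M : cmod) (N : submod M) :=
  proper_submod N /\
  forall N' : submod M, proper_submod N' ->
    (forall a, {subset N a <= N' a}) -> forall a, N' a =i N a.

Definition simple_cmod (M : cmod) :=
  (exists a (x : M a), x != 0) /\
  forall N : submod M, (forall a x, x \in N a -> x = 0) \/ (forall a x, x \in N a).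

Definition cmod_iso (M M' : cmod) := exists f : forall a, M a -> M' a,
  [/\ forall a, linear (@f a), forall a, bijective (@f a)
    & forall a b (u : hom C a b) (x : M a), f b (mact u x) = mact u (f a x)].

(* [set cmod] is a universe inconsistency, hence the plain predicates; for the
   same reason [bijection_onto] replaces [set_bij]. *)
Definition iso_class (M : cmod) : cmod -> Prop := fun M' => cmod_iso M M'.

Definition simple_iso_class (K : cmod -> Prop) : Prop :=
  exists2 M, simple_cmod M & K = iso_class M.

Section Quotient.
Variables (M : cmod) (N : submod M).

Definition mquot_sp (a : C) : lmodType k := vquot (N a).
Definition mquot_act a b (f : hom C a b) (x : mquot_sp a) : mquot_sp b :=
  vpi (N b) (mact f (vrepr x)).

Lemma mquot_actE a b (f : hom C a b) (x : M a) :
  mquot_act f (vpi (N a) x) = vpi (N b) (mact f x).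
Proof.
apply/vpi_eq; have h : vrepr (vpi (N a) x) - x \in N a by apply/vpi_eq; exact: vreprK.
have := ssp_act f h; rewrite -scaleN1r addrC (mact_bilinear M a b).2.
by rewrite scaleN1r addrC.
Qed.

Fact mquot_bilinear a b : is_bilinear (@mquot_act a b).
Proof.
split=> [x r f g|f r x y].
  by rewrite /mquot_act (mact_bilinear M a b).1 linearP.
rewrite -[x]vreprK -[y]vreprK -linearP !mquot_actE.
by rewrite (mact_bilinear M a b).2 linearP.
Qed.

Fact mquot_act1 a (x : mquot_sp a) : mquot_act (idm a) x = x.
Proof. by rewrite -[x]vreprK mquot_actE mact1. Qed.

Fact mquot_actM a b c (g : hom C b c) (f : hom C a b) (x : mquot_sp a) :
  mquot_act (hcomp g f) x = mquot_act g (mquot_act f x).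
Proof. by rewrite -[x]vreprK !mquot_actE mactM. Qed.

Definition mquot : cmod := CMod mquot_bilinear mquot_act1 mquot_actM.
End Quotient.

Fact rep_bilinear (c : C) a b : is_bilinear (fun (g : hom C a b) (f : hom C c a) => hcomp g f).
Proof. exact: hcomp_bilinear. Qed.

(* C(c,-) *)
Definition representable (c : C) : cmod :=
  @CMod (hom C c) (fun a b g f => hcomp g f) (rep_bilinear c)
    (fun a f => hcomp1m f) (fun a b d g f x => esym (hcompA g f x)).

End Modules.

Arguments cmod {k} C.

Section Standard.
Context {k : fieldType} {C : lincat k} (R : reedy C).

Notation Cp := (rplus R).
Notation Cm := (rminus R).
Notation cmap c d := (@comp_map k C Cp Cm c d).

Lemma pcomp_bilinear c d e : is_bilinear (@pcomp k C Cp Cm c d e).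
Proof.
split=> u r x y; first exact: (hcomp_bilinear _ _ _).1.
exact: (hcomp_bilinear _ _ _).2.
Qed.

Lemma comp_map_linear c d : linear (cmap c d).
Proof. by apply: dlift_linear => e; exact/tlift_linear/pcomp_bilinear. Qed.

Lemma comp_map_single c d e (g : scat_hom Cp e d) (h : scat_hom Cm c e) :
  cmap c d (dsingle (i := e) (tens g h)) = hcomp (val g) (val h).
Proof.
rewrite /comp_map dlift_single ?tlift_tens //; first exact: pcomp_bilinear.
by move=> i; exact/tlift_linear/pcomp_bilinear.
Qed.

Lemma comp_map_in c d (S : submodClosed (hom C c d)) (t : fact_space Cp Cm c d) :
  (forall e (g : scat_hom Cp e d) (h : scat_hom Cm c e),
     dproj t e != 0 -> hcomp (val g) (val h) \in S) ->
  cmap c d t \in S.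
Proof.
move=> h; apply: dlift_in => e; have [->|te] := eqVneq (dproj t e) 0.
  have lf := tlift_linear (@pcomp_bilinear c d e).
  suff -> : tlift (@pcomp k C Cp Cm c d e) 0 = 0 by exact: rpred0.
  by have := lf (-1) 0 0; rewrite scaleN1r oppr0 addr0 scaleN1r addNr.
rewrite -(vpreimE S (tlift_linear (@pcomp_bilinear c d e))).
by apply: tensor_ind => g f; rewrite vpreimE tlift_tens ?h //; exact: pcomp_bilinear.
Qed.

(* the image of the part of the direct sum supported on objects of degree < al;
   only al in [rlam R] matters, since al will be the degree of an object *)
Definition low_ideal (al : rlam R) (c d : C) : {pred hom C c d} := fun x =>
  `[< exists2 t : fact_space Cp Cm c d,
        (forall e, ~~ (rdeg R e < al)%O -> dproj t e = 0) & x = cmap c d t >].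

Fact low_ideal_closed al c d : submod_closed (@low_ideal al c d).
Proof.
split=> [|a x y /asboolP[t ht ->] /asboolP[s hs ->]]; apply/asboolP.
  exists 0 => [e _|]; first by [].
  have := @comp_map_linear c d (-1) 0 0.
  by rewrite scaleN1r oppr0 addr0 scaleN1r addNr.
exists (a *: t + s) => [e he|]; last by rewrite comp_map_linear.
by rewrite dprojP ht // hs // scaler0 addr0.
Qed.
HB.instance Definition _ al c d :=
  GRing.isSubmodClosed.Build k (hom C c d) (@low_ideal al c d) (@low_ideal_closed al c d).

Lemma low_ideal_comp al c d e (g : scat_hom Cp e d) (h : scat_hom Cm c e) :
  (rdeg R e < al)%O -> hcomp (val g) (val h) \in @low_ideal al c d.
Proof.
move=> he; apply/asboolP; exists (dsingle (i := e) (tens g h)); last by rewrite comp_map_single.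
by move=> i hi; apply: dproj_single0 => ie; move: hi; rewrite ie he.
Qed.

Lemma comp_map_surj c d (x : hom C c d) : exists t, x = cmap c d t.
Proof. by have [g _ gK] := comp_map_bij R c d; exists (g x). Qed.

Lemma hcomp_linl c d e (f : hom C d e) : linear (fun x : hom C c d => hcomp f x).
Proof. exact: (hcomp_bilinear _ _ _).2. Qed.
Lemma hcomp_linr c d e (f : hom C c d) : linear (fun x : hom C d e => hcomp x f).
Proof. exact: (hcomp_bilinear _ _ _).1. Qed.

Lemma low_ideal_act al c d d' (f : hom C d d') (x : hom C c d) :
  x \in @low_ideal al c d -> hcomp f x \in @low_ideal al c d'.
Proof.
move=> /asboolP[t ht ->]; rewrite -(vpreimE _ (@hcomp_linl c d d' f)).
apply: comp_map_in => e g h te; rewrite vpreimE hcompA.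
have he : (rdeg R e < al)%O.
  by apply: contraNT te => he; apply/eqP/ht.
have [s ->] := comp_map_surj (hcomp f (val g)).
rewrite -(vpreimE _ (@hcomp_linr c e d' (val h))).
apply: comp_map_in => e' g' h' _; rewrite vpreimE -hcompA.
have -> : hcomp (val h') (val h) = val (scat_comp h' h) by [].
have [h'0|h'0] := eqVneq h' 0.
  have -> : val (scat_comp h' h) = 0.
    have := @hcomp_linr c e e' (val h) (-1) 0 0.
    by rewrite h'0 scaleN1r oppr0 addr0 scaleN1r addNr.
  have := @hcomp_linl c e' d' (val g') (-1) 0 0.
  by rewrite scaleN1r oppr0 addr0 scaleN1r addNr => ->; exact: rpred0.
apply: low_ideal_comp; have [ee'|/eqP ee'] := eqVneq e e'; first by rewrite -ee'.
exact: lt_trans ((rminus_inverse R).2 e e' h' h'0 ee') he.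
Qed.

Definition low_ideal_sub (c : C) : submod (representable c) :=
  @Submod k C (representable c) (fun d => @low_ideal (rdeg R c) c d)
    (fun d d' f x => @low_ideal_act (rdeg R c) c d d' f x).

Definition Delta (c : C) : cmod C := mquot (low_ideal_sub c).

Lemma lin0 (U V : lmodType k) (f : U -> V) : linear f -> f 0 = 0.
Proof. by move=> /(_ (-1) 0 0); rewrite scaleN1r oppr0 addr0 scaleN1r addNr. Qed.

Lemma linZ (U V : lmodType k) (f : U -> V) a x : linear f -> f (a *: x) = a *: f x.
Proof. by move=> lf; have := lf a x 0; rewrite (lin0 lf) !addr0. Qed.

Lemma end_span (D : lincat k) (c : D) (x : hom D c c) :
  trivial_end D -> exists a, x = a *: idm c.
Proof.
move=> /(_ c)[f [lf [g _ gK] f1 _]]; exists (g x).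
by rewrite -f1 -(linZ _ _ lf) -[_ *: _]/(g x * 1) mulr1 gK.
Qed.

Lemma end_mod_ideal c (x : hom C c c) :
  exists a, x - a *: idm c \in @low_ideal (rdeg R c) c c.
Proof.
have hS : submod_closed
    (fun x : hom C c c => `[< exists a, x - a *: idm c \in @low_ideal (rdeg R c) c c >]).
  split=> [|a y z /asboolP[b hb] /asboolP[b' hb']]; apply/asboolP.
    by exists 0; rewrite scale0r subrr rpred0.
  exists (a * b + b').
  rewrite scalerDl -scalerA opprD addrACA -scalerBr.
  by rewrite rpredD ?rpredZ.
suff /asboolP : x \in mk_submod hS by [].
have [t ->] := comp_map_surj x; apply: comp_map_in => e g h _; apply/asboolP.
have [ec|/eqP ec] := eqVneq c e; last first.
  exists 0; rewrite scale0r subr0.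
  have [h0|h0] := eqVneq h 0.
    have -> : hcomp (val g) (val h) = 0 by rewrite h0; exact: lin0 (@hcomp_linl c e c (val g)).
    exact: rpred0.
  by apply: low_ideal_comp; exact: (rminus_inverse R).2 h0 ec.
case: _ / ec g h => g h.
have [a ->] := @end_span (scat Cp) c g (rplus_direct R).1.
have [b ->] := @end_span (scat Cm) c h (rminus_inverse R).1.
exists (a * b).
have -> : val (a *: idm (l := scat Cp) c) = a *: idm c by [].
have -> : val (b *: idm (l := scat Cm) c) = b *: idm c by [].
rewrite (linZ _ _ (@hcomp_linr c c c (b *: idm c))) (linZ _ _ (@hcomp_linl c c c (idm c))).
by rewrite hcomp1m scalerA subrr rpred0.
Qed.

Lemma idm_notin_ideal c : idm c \notin @low_ideal (rdeg R c) c c.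
Proof.
apply/negP => /asboolP[t ht e].
pose ip : scat_hom Cp c c := idm (l := scat Cp) c.
pose im : scat_hom Cm c c := idm (l := scat Cm) c.
have : cmap c c (dsingle (i := c : obj C) (tens ip im)) = cmap c c t.
  by rewrite comp_map_single -e /= hcomp1m.
move/(bij_inj (comp_map_bij R c c)) => tE.
have tens0 : tens ip im = 0.
  have := congr1 (fun z => dproj z (c : obj C)) tE.
  by rewrite dproj_single => ->; apply: ht; rewrite ltxx.
have [f [lf [f' fK f'K] f1 _]] := (rplus_direct R).1 c.
have [g [lg [g' gK g'K] g1 _]] := (rminus_inverse R).1 c.
have lf' : linear f' by move=> a x y; rewrite -{1}[x]f'K -{1}[y]f'K -lf fK.
have lg' : linear g' by move=> a x y; rewrite -{1}[x]g'K -{1}[y]g'K -lg gK.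
pose b (x : scat_hom Cp c c) (y : scat_hom Cm c c) : k^o := f' x * g' y.
have hb : is_bilinear b.
  split=> u a x y; rewrite /b.
    by rewrite lf' mulrDl -scalerAl.
  by rewrite lg' mulrDr -scalerAr.
have := tlift_tens hb ip im; rewrite tens0 (lin0 (tlift_linear hb)).
rewrite /b /ip /im -f1 -g1 fK gK mulr1 => /esym/eqP.
by rewrite oner_eq0.
Qed.

Lemma Delta_max_submod (c : C) : exists N : submod (Delta c),
  maximal_submod N /\
  forall N' : submod (Delta c), maximal_submod N' -> forall d, N' d =i N d.
Proof.
pose D := Delta c; pose one : D c := vpi (low_ideal_sub c c) (idm c).
have gen d (x : D d) : exists f : hom C c d, x = mact f one.
  by exists (vrepr x); rewrite [RHS]mquot_actE [mact _ _]hcompm1 vreprK.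
have one_nz : one != 0.
  apply/eqP; rewrite -(raddf0 (vpi (low_ideal_sub c c))) => /vpi_eq.
  by rewrite subr0; apply/negP; exact: idm_notin_ideal.
have span (x : D c) : exists a, x = a *: one.
  have [a ha] := end_mod_ideal (vrepr x : hom C c c).
  by exists a; rewrite -vpiZ -[x]vreprK; apply/vpi_eq.
have hN d : submod_closed (fun x : D d => `[< forall f : hom C d c, mact f x = 0 >]).
  split=> [|a x y /asboolP hx /asboolP hy]; apply/asboolP => f.
    exact/lin0/(mact_bilinear _ _ _).2.
  by rewrite (mact_bilinear _ _ _).2 hx hy scaler0 addr0.
have hNact a b (f : hom C a b) (x : D a) :
    x \in mk_submod (hN a) -> mact f x \in mk_submod (hN b).
  by move=> /asboolP hx; apply/asboolP => g; rewrite -mactM hx.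
pose N := @Submod k C D (fun d => mk_submod (hN d)) hNact.
have properN : proper_submod N.
  exists c, one; apply/negP => /asboolP /(_ (idm c)); rewrite mact1.
  by move/eqP; rewrite (negPf one_nz).
have big (N' : submod D) : proper_submod N' -> forall d, {subset N' d <= N d}.
  move=> [e [y yN']] d x xN'; apply/asboolP => f.
  have [a fx] := span (mact f x); have := ssp_act f xN'; rewrite fx.
  have [->|a0] := eqVneq a 0; first by rewrite scale0r.
  move=> /(rpredZ a^-1); rewrite scalerA mulVf // scale1r => oneN'.
  by case/negP: yN'; have [g ->] := gen _ y; exact: ssp_act.
exists N; split; first split=> //.
  by move=> N' pN' NN' a x; apply/idP/idP; [exact: big|exact: NN'].
move=> N' [pN' maxN'] d x; apply/esym/maxN' => //; exact: big.
Qed.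

Definition max_submod (c : C) : submod (Delta c) := projT1 (cid (Delta_max_submod c)).

Definition simple_top (c : C) : cmod C := mquot (max_submod c).

End Standard.

Definition bijection_onto {A B : Type} (f : A -> B) (P : B -> Prop) :=
  [/\ forall a, P (f a), forall a a', f a = f a' -> a = a'
    & forall b, P b -> exists a, f a = b].

(* Main.v *)
(** Modulo its low ideal, [C(c, e)] is spanned by [C^+(c, e)], so [Delta_c] is
    supported on [c] and on objects of degree larger than [deg c]; hence an
    isomorphism between [L_c] and [L_d] forces [c = d].  Conversely, let [M] be
    simple and [x] a nonzero vector of [M c], with [c] of least degree in the
    support of [M].  The low ideal kills [x] because it factors through
    objects where [M] vanishes, so [x] defines a map [Delta_c -> M]; it is onto
    and its kernel is maximal, i.e. [L_c] is isomorphic to [M]. *)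
From mathcomp Require Import all_boot all_order all_algebra.
From mathcomp Require Import boolp.
Require Import Defs.

Set Implicit Arguments.
Unset Strict Implicit.
Unset Printing Implicit Defensive.

Import Order.TTheory GRing.Theory.

Local Open Scope ring_scope.

(** * Morphisms of modules: kernels, images, quotients and simplicity *)

Section ModuleMaps.
Context {k : fieldType} {C : lincat k}.
Implicit Types M : cmod C.

Definition cmod_hom M M' (f : forall a, M a -> M' a) :=
  (forall a, linear (@f a)) /\
  forall a b (u : hom C a b) (x : M a), f b (mact u x) = mact u (f a x).

Lemma mact_linear M a b (u : hom C a b) : linear (@mact k C M a b u).
Proof. exact: (mact_bilinear M a b).2. Qed.

Lemma mact_linear_hom M a b (x : M a) :
  linear (fun u : hom C a b => @mact k C M a b u x).
Proof. exact: (mact_bilinear M a b).1. Qed.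

Lemma linear_sub (U V : lmodType k) (f : U -> V) x y :
  linear f -> f (x - y) = f x - f y.
Proof. by move=> lf; rewrite addrC -scaleN1r lf scaleN1r addrC. Qed.

Lemma cmod_iso_refl M : cmod_iso M M.
Proof. by exists (fun a x => x); split=> // a; exists id. Qed.

Lemma cmod_iso_sym M M' : cmod_iso M M' -> cmod_iso M' M.
Proof.
move=> [f [lf bf nf]].
have inv a : exists g : M' a -> M a, cancel (f a) g /\ cancel g (f a).
  by have [g fK gK] := bf a; exists g.
have gP a := projT2 (cid (inv a)); set g := fun a => projT1 (cid (inv a)).
exists g; split=> [a r x y|a|a b u x].
- by apply: (can_inj (gP a).1); rewrite lf !(gP a).2.
- by exists (f a); case: (gP a).
- by apply: (can_inj (gP b).1); rewrite nf (gP a).2 (gP b).2.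
Qed.

Lemma cmod_iso_trans M1 M2 M3 :
  cmod_iso M1 M2 -> cmod_iso M2 M3 -> cmod_iso M1 M3.
Proof.
move=> [f [lf bf nf]] [g [lg bg ng]]; exists (fun a x => g a (f a x)).
split=> [a r x y|a|a b u x]; first by rewrite lf lg.
  exact: bij_comp (bg a) (bf a).
by rewrite nf ng.
Qed.

(** Classes are predicates, so their equality comes from extensionality once isomorphism is an
    equivalence relation. *)
Lemma iso_class_eq M M' : iso_class M = iso_class M' <-> cmod_iso M M'.
Proof.
split=> [e|MM'].
  have : iso_class M' M' by exact: cmod_iso_refl.
  by rewrite -e.
apply: funext => K; apply: propext; split; apply: cmod_iso_trans => //.
exact: cmod_iso_sym.
Qed.

Section Hom.
Context {M M' : cmod C} (f : forall a, M a -> M' a) (hf : cmod_hom f).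

Definition preim_submod (N : submod M') : submod M.
Proof.
apply: (@Submod k C M (fun a => vpreim (N a) (hf.1 a))) => a b u x.
by move=> fxN; rewrite vpreimE hf.2; exact: ssp_act.
Defined.

Fact image_closed (N : submod M) a :
  submod_closed (fun y : M' a => `[< exists2 x, x \in N a & y = f x >]).
Proof.
split=> [|r y z /asboolP[x xN ->] /asboolP[x' xN' ->]]; apply/asboolP.
  by exists 0; [exact: rpred0|rewrite (lin0 (hf.1 a))].
by exists (r *: x + x'); [rewrite rpredD ?rpredZ|rewrite hf.1].
Qed.

Definition image_submod (N : submod M) : submod M'.
Proof.
apply: (@Submod k C M' (fun a => mk_submod (image_closed N a))) => a b u y.
move=> /asboolP[x xN ->]; apply/asboolP.
by exists (mact u x); [exact: ssp_act|rewrite hf.2].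
Defined.

Lemma image_submodP (N : submod M) a (y : M' a) :
  reflect (exists2 x, x \in N a & y = f x) (y \in image_submod N a).
Proof. exact: asboolP. Qed.

(** Universal property of the quotient: two representatives of a class differ by an element of [N],
    which [f] kills. *)
Lemma mquot_lift (N : submod M) : (forall a x, x \in N a -> f x = 0) ->
  exists2 g : forall a, mquot N a -> M' a, cmod_hom g &
    forall a x, g a (vpi (N a) x) = f x.
Proof.
move=> fN; pose g a (y : mquot N a) : M' a := f (vrepr y).
have gE a x : g a (vpi (N a) x) = f x.
  apply/eqP; rewrite -subr_eq0 -(linear_sub _ _ (hf.1 a)); apply/eqP/fN/vpi_eq.
  exact: vreprK.
exists g => //; split=> [a r x y|a b u x].
  by rewrite -[x]vreprK -[y]vreprK -linearP !gE hf.1.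
by rewrite -[x]vreprK [mact _ _]mquot_actE !gE hf.2.
Qed.

(** First isomorphism theorem; the inverse picks a preimage under [f] and takes its class. *)
Lemma mquot_iso (N : submod M) :
  (forall a (x : M a), (x \in N a) = (f x == 0)) ->
  (forall a (y : M' a), exists x, y = f x) -> cmod_iso (mquot N) M'.
Proof.
move=> kerf surjf.
have [|g hg gE] := @mquot_lift N; first by move=> a x; rewrite kerf => /eqP.
have [lg ng] := hg.
exists g; split=> // a.
have [s sP] := choice (surjf a).
exists (fun y => vpi (N a) (s y)) => y; last by rewrite gE -sP.
rewrite -[y]vreprK gE; apply/vpi_eq.
by rewrite kerf (linear_sub _ _ (hf.1 a)) -sP subrr.
Qed.

End Hom.

Lemma vpi_cmod_hom M (N : submod M) :
  cmod_hom (M' := mquot N) (fun a => @vpi k (M a) (N a)).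
Proof.
by split=> [a r x y|a b u x]; [exact: linearP|rewrite [RHS]mquot_actE].
Qed.

Lemma vpi_eq0 M (N : submod M) a (x : M a) :
  (vpi (N a) x == 0) = (x \in N a).
Proof.
have e : vpi (N a) 0 = 0 by exact: raddf0.
apply/eqP/idP => [|xN]; rewrite -e; first by move=> /vpi_eq; rewrite subr0.
by apply/vpi_eq; rewrite subr0.
Qed.

Lemma simple_mquot M (N : submod M) : maximal_submod N -> simple_cmod (mquot N).
Proof.
move=> [[a [x xN]] maxN]; split.
  by exists a, (vpi (N a) x); rewrite vpi_eq0.
move=> Q; have hpi := vpi_cmod_hom N; pose P := preim_submod hpi Q.
have PE b (y : M b) : (y \in P b) = (vpi (N b) y \in Q b) by [].
have NP b : {subset N b <= P b}.
  by move=> y; rewrite PE -vpi_eq0 => /eqP ->; exact: rpred0.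
(* The pullback [P] of [Q] contains [N]: if proper, it equals [N] and [Q] is zero; otherwise [P],
   and so [Q], is everything. *)
have [pP|npP] := pselect (proper_submod P); [left|right] => b y.
  move=> yQ; apply/eqP; move: yQ; rewrite -[y]vreprK -PE vpi_eq0.
  by rewrite (maxN P pP NP).
apply: contrapT => /negP yQ; apply: npP; exists b, (vrepr y).
by rewrite PE vreprK.
Qed.

Section ToSimple.
Context {M M' : cmod C} (f : forall a, M a -> M' a) (hf : cmod_hom f).
Hypotheses (simM' : simple_cmod M') (fn0 : exists a (x : M a), f x != 0).

Lemma hom_simple_surj a (y : M' a) : exists x, y = f x.
Proof.
(* The range of [f] is the image of the whole module; being nonzero, it is all of [M']. *)
have full_closed b : submod_closed (fun _ : M b => true) by [].
pose full := @Submod k C M (fun b => mk_submod (full_closed b))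
  (fun _ _ _ _ _ => isT).
have [im0|imT] := simM'.2 (image_submod hf full).
  have [b [x /eqP[]]] := fn0; apply: im0; apply/image_submodP.
  by exists x.
by have /image_submodP[x _ ->] := imT a y; exists x.
Qed.

Lemma ker_maximal (N : submod M) :
  (forall a (x : M a), (x \in N a) = (f x == 0)) -> maximal_submod N.
Proof.
move=> kerf; split.
  by have [a [x fx0]] := fn0; exists a, x; rewrite kerf.
move=> Q [b [z zQ]] NQ a x; apply/idP/idP => [xQ|]; last exact: NQ.
have [im0|imT] := simM'.2 (image_submod hf Q).
  by rewrite kerf; apply/eqP/im0/image_submodP; exists x.
(* If [Q] maps onto [M'], the missing vector [z] differs from some [y] in [Q] by a kernel element,
   which also lies in [Q]. *)
have /image_submodP[y yQ fzy] := imT b (f z).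
case/negP: zQ; rewrite -[z](subrK y) rpredD //; apply: NQ.
by rewrite kerf (linear_sub _ _ (hf.1 b)) fzy subrr.
Qed.

Definition ker_submod : submod M.
Proof.
apply: (@Submod k C M (fun a => vpreim (vzero (V := M' a)) (hf.1 a))) => a b u x.
by move=> /eqP fx0; rewrite vpreimE vzeroE hf.2 fx0 (lin0 (mact_linear u)).
Defined.

Lemma ker_submodE a (x : M a) : (x \in ker_submod a) = (f x == 0).
Proof. by []. Qed.

End ToSimple.
End ModuleMaps.

(** * Degrees, the support of the simple modules, and the classification *)

Section Reedy.
Context {k : fieldType} {C : lincat k} (R : reedy C).

Lemma max_submod_maximal c : maximal_submod (max_submod R c).
Proof. exact: (projT2 (cid (Delta_max_submod R c))).1. Qed.

Lemma max_submod_unique c (N : submod (Delta R c)) :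
  maximal_submod N -> forall d, N d =i max_submod R c d.
Proof. exact: (projT2 (cid (Delta_max_submod R c))).2. Qed.

Lemma simple_top_simple c : simple_cmod (simple_top R c).
Proof. exact/simple_mquot/max_submod_maximal. Qed.

(** In a product of [h : c -> e'] in [C^-] and [g : e' -> e] in [C^+], a nonzero [h] either lowers
    the degree, which puts the product in the ideal, or has [e' = c]; then [g] vanishes, as a
    nonzero one would raise the degree. *)
Lemma low_ideal_full c e (x : hom C c e) :
  c <> e -> ~~ (rdeg R c < rdeg R e)%O -> x \in low_ideal_sub R c e.
Proof.
move=> ce degce; have [t ->] := comp_map_surj R x.
apply: comp_map_in => e' g h _.
have [h0|h0] := eqVneq h 0.
  by rewrite h0 (lin0 (@hcomp_linl _ _ c e' e (val g))) rpred0.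
have [ce'|/eqP ce'] := eqVneq c e'; last first.
  by apply: low_ideal_comp; exact: (rminus_inverse R).2 h0 ce'.
case: _ / ce' g h h0 => g h _.
have [->|g0] := eqVneq g 0.
  by rewrite (lin0 (@hcomp_linr _ _ c c e (val h))) rpred0.
by case/negP: degce; exact: (rplus_direct R).2 g0 ce.
Qed.

Lemma simple_top_deg c e (y : simple_top R c e) :
  y != 0 -> c <> e -> (rdeg R c < rdeg R e)%O.
Proof.
move=> y0 ce; apply: contraNT y0 => degce.
(* Two lifts are needed: from [L_c] to [Delta_c], then to [C(c, e)]. *)
rewrite -[y]vreprK -[vrepr y]vreprK.
have -> : vpi (low_ideal_sub R c e) (vrepr (vrepr y)) = 0.
  by apply/eqP; rewrite vpi_eq0; exact: low_ideal_full.
by rewrite raddf0.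
Qed.

Definition Delta_one c : Delta R c c := vpi (low_ideal_sub R c c) (idm c).

Lemma Delta_gen c d (x : Delta R c d) : exists u, x = mact u (Delta_one c).
Proof.
by exists (vrepr x); rewrite [RHS]mquot_actE [mact _ _]hcompm1 vreprK.
Qed.

(** The class of the identity generates [Delta_c], so no proper submodule contains it. *)
Lemma simple_top_neq0 c : exists y : simple_top R c c, y != 0.
Proof.
exists (vpi (max_submod R c c) (Delta_one c)); rewrite vpi_eq0.
have [[d [x /negP xN]] _] := max_submod_maximal c.
apply/negP => oneN; apply: xN; have [u ->] := Delta_gen x.
exact: ssp_act.
Qed.

Lemma simple_top_iso_inj c d :
  cmod_iso (simple_top R c) (simple_top R d) -> c = d.
Proof.
(* The isomorphism makes [L_b] nonzero at [a], so [a] has the larger degree; by symmetry this would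
   hold both ways. *)
have deg a b : a <> b -> cmod_iso (simple_top R a) (simple_top R b) ->
    (rdeg R b < rdeg R a)%O.
  move=> ab [f [lf bf _]]; have [y y0] := simple_top_neq0 a.
  apply: (@simple_top_deg b a (f a y)); last exact: nesym.
  by rewrite -(lin0 (lf a)) (inj_eq (bij_inj (bf a))).
move=> cd; apply: contrapT => ncd.
have := lt_trans (deg _ _ ncd cd) (deg _ _ (nesym ncd) (cmod_iso_sym cd)).
by rewrite ltxx.
Qed.

Lemma low_ideal_annihilates (M : cmod C) c (x : M c) :
  (forall e, (rdeg R e < rdeg R c)%O -> forall z : M e, z = 0) ->
  forall d (u : hom C c d), u \in low_ideal_sub R c d -> mact u x = 0.
Proof.
move=> M0 d u /asboolP[t ht ->]; apply/eqP; rewrite -vzeroE.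
rewrite -(vpreimE _ (mact_linear_hom x)).
apply: comp_map_in => e g h te; rewrite vpreimE vzeroE mactM.
have he : (rdeg R e < rdeg R c)%O by apply: contraNT te => he; apply/eqP/ht.
by rewrite (M0 e he (mact _ x)) (lin0 (mact_linear _)).
Qed.

Lemma min_degree_support (M : cmod C) : (exists a (x : M a), x != 0) ->
  exists c, (exists x : M c, x != 0) /\
    forall e, (rdeg R e < rdeg R c)%O -> forall z : M e, z = 0.
Proof.
move=> [a [x x0]]; move: {2}(rdeg R a) (erefl (rdeg R a)) => n.
elim/(well_founded_ind (@rlam_wf _ _ R)): n a x x0 => n IH a x x0 an.
(* Well-founded descent: either the support has an object of smaller degree, or [a] is already
   minimal. *)
have [[e [ea [z z0]]]|none] :=
  pselect (exists e, (rdeg R e < n)%O /\ exists z : M e, z != 0).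
  exact: IH ea _ _ z0 erefl.
exists a; split; first by exists x.
move=> e; rewrite an => en z; apply/eqP/negPn/negP => z0.
by apply: none; exists e; split=> //; exists z.
Qed.

Lemma simple_top_surj (M : cmod C) :
  simple_cmod M -> exists c, cmod_iso (simple_top R c) M.
Proof.
move=> simM; have [c [[x x0] M0]] := min_degree_support simM.1.
(* The map [C(c,-) -> M] that the Yoneda lemma attaches to [x]. *)
pose yoneda a (u : representable c a) : M a := mact u x.
have hy : cmod_hom yoneda.
  by split=> [a|a b u v]; [exact: mact_linear_hom|exact: mactM].
have [|f hf fE] := mquot_lift hy (N := low_ideal_sub R c).
  exact: low_ideal_annihilates.
have fn0 : exists a y, f a y != 0.
  by exists c, (Delta_one c); rewrite fE /yoneda mact1.
(* Uniqueness of the maximal submodule identifies the kernel with the one chosen in [simple_top]. *)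
have kerE := max_submod_unique (ker_maximal hf simM fn0 (ker_submodE hf)).
exists c; apply: (mquot_iso hf) => [a y|].
  by rewrite -kerE ker_submodE.
exact: hom_simple_surj hf simM fn0.
Qed.

End Reedy.

Theorem theorem4p14 (k : fieldType) (C : lincat k) (R : reedy C) :
  bijection_onto (fun c : C => iso_class (simple_top R c)) simple_iso_class.
Proof.
split=> [c|c d /iso_class_eq|_ [M simM ->]].
- by exists (simple_top R c) => //; exact: simple_top_simple.
- exact: simple_top_iso_inj.
- by have [c cM] := simple_top_surj R simM; exists c; apply/iso_class_eq.
Qed.
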